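(* Let $G_1,G_2$ be abelian groups and $n,m\ge0$ natural numbers. Let $c:K(G_2\otimes G_1,m+n)\simeq K(G_1\otimes G_2,n+m)$ be the equivalence induced by the swap isomorphism $G_2\otimes G_1\cong G_1\otimes G_2$ (and the equality $m+n=n+m$). Then for all $x:K(G_1,n)$ and $y:K(G_2,m)$, $$x\smile_k y=c\big((-1)^{nm}(y\smile_k x)\big).$$
   Context: We work in Homotopy Type Theory (as in the HoTT Book). $\Omega(A):=(\star_A=\star_A)$ for a pointed type $(A,\star_A)$; $A\to_\star B$ is the type of pointed maps. $\Sigma A$ is the suspension, with constructors $\mathsf{north},\mathsf{south}$ and $\mathsf{merid}\,a:\mathsf{north}=\mathsf{south}$ for $a:A$. $\|A\|_n$ is the $n$-truncation, with canonical elements $|a|$. Eilenberg-MacLane spaces. For an abelian group $G$, $\widetilde K(G,1)$ is the higher inductive type generated by a point $\star$, a path $\mathsf{loop}_k\,g:\star=\star$ for every $g:G$, and for all $g_1,g_2:G$ a filler witnessing $\mathsf{loop}_k\,g_1\cdot\mathsf{loop}_k\,g_2=\mathsf{loop}_k(g_1+g_2)$. For $n>1$, $\widetilde K(G,n):=\Sigma\,\widetilde K(G,n-1)$. The basepoint $0_k$ of $\widetilde K(G,n)$ is $\star$ if $n=1$ and $\mathsf{north}$ if $n>1$. $K(G,0):=G$ with basepoint $0_G$, and $K(G,n):=\|\widetilde K(G,n)\|_n$ with basepoint $|0_k|$ for $n\ge1$; all basepoints are written $0_k$. A homomorphism $\phi:G_1\to G_2$ induces $\phi_n:K(G_1,n)\to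 K(G_2,n)$: $\phi_0:=\phi$; $\phi_1(\star):=\star$ and $\mathsf{ap}_{\phi_1}(\mathsf{loop}_k\,g):=\mathsf{loop}_k(\phi(g))$; $\phi_n:=\Sigma(\phi_{n-1})$ for $n\ge2$ (on raw spaces). The map $\sigma_n:K(G,n)\to\Omega K(G,n+1)$ is $\sigma_0(g):=\mathsf{loop}_k\,g$ and, for $n\ge1$, is induced by $x\mapsto\mathsf{merid}\,x\cdot(\mathsf{merid}\,0_k)^{-1}$ for $x:\widetilde K(G,n)$. Negation. $-_k:K(G,n)\to K(G,n)$ is negation of $G$ for $n=0$; for $n=1$ it sends $\star$ to $\star$ and $\mathsf{loop}_k\,g$ to $(\mathsf{loop}_k\,g)^{-1}$; for $n\ge2$ it sends $\mathsf{north},\mathsf{south}$ to $\mathsf{north}$ and $\mathsf{merid}\,a$ to $(\mathsf{merid}\,a\cdot(\mathsf{merid}\,0_k)^{-1})^{-1}$. For $p:\mathbb N$, $(-1)^p u$ means $u$ if $p$ is even and $-_k\,u$ if $p$ is odd. Cup product. $G_1\otimes G_2$ is the tensor product of abelian groups (a set, constructed as a higher inductive type, with the usual universal property). First define $\smile_k':\widetilde K(G_1,n)\times K(G_2,m)\to K(G_1\otimes G_2,n+m)$ (with $\widetilde K(G_1,0):=G_1$). For $n=0$, $g\smile_k'(-):=(g\otimes(-))_m$, the functorial action on the homomorphism $g\otimes(-):G_2\to G_1\otimes G_2$. For $n=1$, $\star\smile_k'y:=0_k$ and $\mathsf{ap}_{x\mapsto x\smile_k'y}(\mathsf{loop}_k\,g):=\sigma_m(g\smile_k'y)$.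 For $n\ge2$, $\mathsf{north}\smile_k'y:=0_k$, $\mathsf{south}\smile_k'y:=0_k$ and $\mathsf{ap}_{x\mapsto x\smile_k'y}(\mathsf{merid}\,a):=\sigma_{(n-1)+m}(a\smile_k'y)$. Each $x\smile_k'(-)$ is pointed, so $\smile_k'$ is a map $\widetilde K(G_1,n)\to(K(G_2,m)\to_\star K(G_1\otimes G_2,n+m))$; the codomain is an $n$-type, so it lifts uniquely to $\smile_k:K(G_1,n)\to(K(G_2,m)\to_\star K(G_1\otimes G_2,n+m))$. *)

(* Defs.v *)
(* Book homotopy type theory, developed inside plain Rocq (Stdlib prelude
   only, no axioms).

   The identity type is an inductive family in [Type], so that it carries
   higher structure, and the symbol [=] stands for it throughout this file;
   [Logic.eq] is not used.  Function extensionality and the higher inductive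
   types (with their full dependent eliminators and computation rules on all
   constructors, up to paths) are explicit arguments, gathered in the classes
   [Funext] and [HITs].  Univalence is not used by any construction below and
   is not assumed. *)

From Stdlib Require Import PeanoNat.

(** * Identity types *)

Inductive paths {A : Type} (a : A) : A -> Type := idpath : paths a a.
Arguments idpath {A a}, [A] a.

Declare Scope path_scope.
Delimit Scope path_scope with path.
Local Notation "x = y :> A" := (@paths A x y) : type_scope.
Local Notation "x = y" := (paths x y) : type_scope.
Open Scope path_scope.

Definition concat {A} {x y z : A} (p : x = y) (q : y = z) : x = z :=
  match q in _ = t return x = t with idpath => p end.
Definition inverse {A} {x y : A} (p : x = y) : y = x :=
  match p in _ = t return t = x with idpath => idpath end.
Notation "p @ q" := (concat p q) (at level 20, left associativity) : path_scope.
Notation "! p" := (inverse p) (at level 3, right associativity, format "! p")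
  : path_scope.

Definition ap {A B} (f : A -> B) {x y : A} (p : x = y) : f x = f y :=
  match p in _ = t return f x = f t with idpath => idpath end.
Definition transport {A} (P : A -> Type) {x y : A} (p : x = y) (u : P x) : P y :=
  match p in _ = t return P t with idpath => u end.

Definition DPath {A} (P : A -> Type) {x y : A} (p : x = y) (u : P x) (v : P y)
  : Type := transport P p u = v.
Definition apD {A} {P : A -> Type} (f : forall x, P x) {x y : A} (p : x = y)
  : DPath P p (f x) (f y) :=
  match p in _ = t return DPath P p (f x) (f t) with idpath => idpath end.
Definition dconcat {A} {P : A -> Type} {x y z : A} {p : x = y} {q : y = z}
  {u : P x} {v : P y} {w : P z} (r : DPath P p u v)
  : DPath P q v w -> DPath P (p @ q) u w :=
  match q as q' in _ = t
    return forall w : P t, DPath P q' v w -> DPath P (p @ q') u w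
  with idpath => fun w s => r @ s end w.
Definition apD_pp {A} {P : A -> Type} (f : forall x, P x) {x y z : A}
  (p : x = y) (q : y = z) : dconcat (apD f p) (apD f q) = apD f (p @ q) :=
  match q as q' in _ = t
    return dconcat (apD f p) (apD f q') = apD f (p @ q')
  with idpath => idpath end.

Definition happly {A} {P : A -> Type} {f g : forall x, P x} (p : f = g)
  : forall x, f x = g x := fun x => ap (fun h => h x) p.

Definition IsEquiv {A B} (f : A -> B) : Type :=
  ({g : B -> A & forall x, g (f x) = x} * {h : B -> A & forall y, f (h y) = y})%type.

Class Funext := isequiv_happly :
  forall (A : Type) (P : A -> Type) (f g : forall x, P x),
    IsEquiv (@happly A P f g).

Definition funext {fe : Funext} {A} {P : A -> Type} {f g : forall x, P x}
  (h : forall x, f x = g x) : f = g := projT1 (snd (isequiv_happly A P f g)) h.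

(** * Homotopy levels *)

Definition Contr (A : Type) : Type := {c : A & forall x, c = x}.
Fixpoint hlevel (k : nat) (A : Type) : Type :=
  match k with
  | 0 => Contr A
  | S k' => forall x y : A, hlevel k' (x = y)
  end.
Definition IsProp (A : Type) : Type := hlevel 1 A.
Definition IsSet (A : Type) : Type := hlevel 2 A.
(* The numbering of [hlevel] starts at the contractible types. *)
Definition IsNType (n : nat) (A : Type) : Type := hlevel (S (S n)) A.

(** * Abelian groups *)

Record AbGroup := {
  carrier :> Type;
  carrier_set : IsSet carrier;
  zero : carrier;
  add : carrier -> carrier -> carrier;
  opp : carrier -> carrier;
  addA : forall x y z, add x (add y z) = add (add x y) z;
  addC : forall x y, add x y = add y x;
  add0 : forall x, add zero x = x;
  addN : forall x, add (opp x) x = zero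
}.
Arguments zero {a}.
Arguments add {a}.
Arguments opp {a}.
Arguments addA {a}.
Arguments addC {a}.
Arguments add0 {a}.
Arguments addN {a}.

Record Hom (G H : AbGroup) := mkHom {
  hom_fun :> G -> H;
  hom_add : forall x y, hom_fun (add x y) = add (hom_fun x) (hom_fun y)
}.

Definition Bilinear {G1 G2 H : AbGroup} (b : G1 -> G2 -> H) : Type :=
  ((forall x x' y, b (add x x') y = add (b x y) (b x' y)) *
   (forall x y y', b x (add y y') = add (b x y) (b x y')))%type.

(** * Higher inductive types *)

(* For each higher inductive type, [XData] is the type of premises of the
   dependent eliminator into a family [P], and [XRestr f] is the family of
   values of a section [f] on the constructors.  The eliminator returns a
   section whose restriction is the given one: this single path contains the
   computation rules for all constructors. *)

Definition SuspData {A S : Type} {N S' : S} (m : A -> N = S') (P : S -> Type)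
  : Type :=
  {n : P N & {s : P S' & forall a, DPath P (m a) n s}}.
Definition SuspRestr {A S : Type} {N S' : S} (m : A -> N = S') {P : S -> Type}
  (f : forall x, P x) : SuspData m P :=
  existT _ (f N) (existT _ (f S') (fun a => apD f (m a))).

Definition K1Data {G : AbGroup} {K : Type} {pt : K} {l : G -> pt = pt}
  (fill : forall g1 g2, l g1 @ l g2 = l (add g1 g2)) (P : K -> Type) : Type :=
  {b : P pt & {r : forall g, DPath P (l g) b b &
    forall g1 g2, DPath (fun q => DPath P q b b) (fill g1 g2)
                    (dconcat (r g1) (r g2)) (r (add g1 g2))}}.
Definition K1Restr {G : AbGroup} {K : Type} {pt : K} {l : G -> pt = pt}
  (fill : forall g1 g2, l g1 @ l g2 = l (add g1 g2)) {P : K -> Type}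
  (f : forall x, P x) : K1Data fill P :=
  existT _ (f pt) (existT _ (fun g => apD f (l g))
    (fun g1 g2 =>
       ap (transport (fun q => DPath P q (f pt) (f pt)) (fill g1 g2))
          (apD_pp f (l g1) (l g2))
       @ apD (fun q => apD f q) (fill g1 g2))).

Class HITs := {
  Susp : Type -> Type;
  north : forall {A}, Susp A;
  south : forall {A}, Susp A;
  merid : forall {A}, A -> @north A = @south A;
  Susp_ind : forall A (P : Susp A -> Type) (d : SuspData (@merid A) P),
    {f : forall x, P x & SuspRestr (@merid A) f = d};

  Trunc : nat -> Type -> Type;
  tr : forall {n A}, A -> Trunc n A;
  Trunc_ntype : forall n A, IsNType n (Trunc n A);
  Trunc_ind : forall n A (P : Trunc n A -> Type),
    (forall x, IsNType n (P x)) -> forall d : (forall a, P (tr a)),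
    {f : forall x, P x & forall a, f (tr a) = d a};

  K1 : AbGroup -> Type;
  star : forall {G}, K1 G;
  loop : forall {G : AbGroup}, G -> @star G = @star G;
  loop_add : forall {G : AbGroup} (g1 g2 : G),
    loop g1 @ loop g2 = loop (add g1 g2);
  K1_ind : forall (G : AbGroup) (P : K1 G -> Type) (d : K1Data (@loop_add G) P),
    {f : forall x, P x & K1Restr (@loop_add G) f = d};

  Tensor : AbGroup -> AbGroup -> AbGroup;
  tens : forall {G1 G2 : AbGroup}, G1 -> G2 -> Tensor G1 G2;
  tens_bilinear : forall G1 G2, Bilinear (@tens G1 G2);
  Tensor_univ : forall (G1 G2 H : AbGroup) (b : G1 -> G2 -> H), Bilinear b ->
    Contr {f : Hom (Tensor G1 G2) H & forall x y, f (tens x y) = b x y}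
}.

(** * Path algebra *)

Lemma concat_1p {A} {x y : A} (p : x = y) : idpath @ p = p.
Proof. destruct p; exact idpath. Defined.
Lemma concat_pp {A} {x y z w : A} (p : x = y) (q : y = z) (r : z = w) :
  p @ (q @ r) = (p @ q) @ r.
Proof. destruct r; exact idpath. Defined.
Lemma concat_Vp {A} {x y : A} (p : x = y) : !p @ p = idpath.
Proof. destruct p; exact idpath. Defined.
Lemma concat_pV {A} {x y : A} (p : x = y) : p @ !p = idpath.
Proof. destruct p; exact idpath. Defined.
Lemma inv_pp {A} {x y z : A} (p : x = y) (q : y = z) : !(p @ q) = !q @ !p.
Proof. destruct q, p; exact idpath. Defined.
Lemma ap_pp {A B} (f : A -> B) {x y z : A} (p : x = y) (q : y = z) :
  ap f (p @ q) = ap f p @ ap f q.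
Proof. destruct q; exact idpath. Defined.
Lemma ap_V {A B} (f : A -> B) {x y : A} (p : x = y) : ap f (!p) = !(ap f p).
Proof. destruct p; exact idpath. Defined.
Lemma ap_comp {A B C} (g : B -> C) (f : A -> B) {x y : A} (p : x = y) :
  ap (fun x => g (f x)) p = ap g (ap f p).
Proof. destruct p; exact idpath. Defined.
Lemma cancelL {A} {x y z : A} (p : x = y) (q r : y = z) (h : p @ q = p @ r) : q = r.
Proof.
  destruct p.
  exact (!(concat_1p q) @ h @ concat_1p r).
Defined.

Lemma transport_const {A B} {x y : A} (p : x = y) (b : B) :
  transport (fun _ => B) p b = b.
Proof. destruct p; exact idpath. Defined.
Lemma apD_const {A B} (f : A -> B) {x y : A} (p : x = y) :
  apD (P := fun _ => B) f p = transport_const p (f x) @ ap f p.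
Proof. destruct p; exact idpath. Defined.

Definition concat2 {A} {x y z : A} {p p' : x = y} {q q' : y = z}
  (h : p = p') (k : q = q') : p @ q = p' @ q' :=
  ap (fun t => t @ q) h @ ap (fun t => p' @ t) k.

Definition conj {A} {x y : A} (e : x = y) (p : x = x) : y = y := !e @ p @ e.
Lemma conj_pp {A} {x y : A} (e : x = y) (p q : x = x) :
  conj e p @ conj e q = conj e (p @ q).
Proof. destruct e; unfold conj; simpl.
  exact (concat2 (concat_1p p) (concat_1p q) @ !(concat_1p (p @ q))).
Defined.
Lemma conj_conj {A} {x y z : A} (e : x = y) (d : y = z) (p : x = x) :
  conj (e @ d) p = conj d (conj e p).
Proof. destruct d, e; unfold conj; simpl. exact (!(concat_1p _)). Defined.
Lemma conj_ap {A B} (f : A -> B) {x y : A} (e : x = y) (p : x = x) :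
  ap f (conj e p) = conj (ap f e) (ap f p).
Proof. destruct e; unfold conj; simpl. exact (ap_pp f idpath p). Defined.
Lemma conj_idpath {A} {x y : A} (e : x = y) : conj e idpath = idpath.
Proof. destruct e; exact idpath. Defined.
Lemma conj_eq {A} {x y : A} (e : x = y) (p : x = x) (q : y = y) (h : conj e p = q) :
  p = conj (!e) q.
Proof.
  destruct e; unfold conj in *; simpl in *.
  exact (!(concat_1p p) @ h @ !(concat_1p q)).
Defined.

Lemma transport_paths {A B} (f g : A -> B) {x y : A} (p : x = y) (r : f x = g x)
  (s : f y = g y) (h : r @ ap g p = ap f p @ s)
  : DPath (fun z => f z = g z) p r s.
Proof.
  destruct p; unfold DPath; simpl in *. exact (h @ concat_1p s).
Defined.

(** * Closure properties of homotopy levels *)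

Lemma contr_path {A} (c : Contr A) (x y : A) : x = y.
Proof. exact (!(projT2 c x) @ projT2 c y). Defined.

Lemma contr_paths {A} (c : Contr A) (x y : A) : Contr (x = y).
Proof.
  exists (contr_path c x y). intros p; destruct p.
  unfold contr_path. apply concat_Vp.
Defined.

Lemma hlevel_up {k A} : hlevel k A -> hlevel (S k) A.
Proof.
  revert A; induction k as [|k IH]; intros A h.
  - exact (contr_paths h).
  - intros x y; exact (IH _ (h x y)).
Defined.

Lemma hlevel_le k {j A} : hlevel j A -> hlevel (k + j) A.
Proof. intros h; induction k; [exact h|exact (hlevel_up IHk)]. Defined.

Lemma hlevel_retract k : forall {A B} (s : A -> B) (r : B -> A),
  (forall a, r (s a) = a) -> hlevel k B -> hlevel k A.
Proof.
  induction k as [|k IH]; intros A B s r rs h.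
  - exists (r (projT1 h)). intros a. exact (ap r (projT2 h (s a)) @ rs a).
  - intros x y.
    apply (IH _ (s x = s y) (fun p => ap s p)
             (fun q => !(rs x) @ ap r q @ rs y)).
    + intros p; destruct p; simpl. apply concat_Vp.
    + apply h.
Defined.

Lemma isprop_path {A} (h : IsProp A) (x y : A) : x = y.
Proof. exact (projT1 (h x y)). Defined.

(** * Pointed sections and pointed maps *)

Definition PSec {A : Type} (a0 : A) (P : A -> Type) (p0 : P a0) : Type :=
  {f : forall x, P x & f a0 = p0}.

Definition PMap (A : Type) (a0 : A) (B : Type) (b0 : B) : Type :=
  @PSec A a0 (fun _ => B) b0.

Definition ev {A a0 P p0} (y : A) (f : @PSec A a0 P p0) : P y := projT1 f y.

Definition path_PSec {A a0 P p0} (f g : @PSec A a0 P p0)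
  (p : projT1 f = projT1 g) (c : happly p a0 = projT2 f @ !(projT2 g)) : f = g.
Proof.
  destruct f as [f a], g as [g b]; simpl in *.
  destruct p; unfold happly in c; simpl in c.
  destruct b; simpl in c.
  exact (ap (existT _ f) (!c)).
Defined.

Lemma ap_ev_path_PSec {A a0 P p0} (f g : @PSec A a0 P p0)
  (p : projT1 f = projT1 g) (c : happly p a0 = projT2 f @ !(projT2 g)) (y : A) :
  ap (ev y) (path_PSec f g p c) = happly p y.
Proof.
  destruct f as [f a], g as [g b]; simpl in *.
  destruct p; unfold happly in c; simpl in c.
  destruct b; simpl in c. unfold ev, happly; simpl.
  refine (!(ap_comp _ _ _) @ _); simpl.
  generalize (!c); intros d. destruct d. exact idpath.
Defined.

(* A pointwise, basepoint-compatible identification of pointed sections. *)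
Definition PHtpy {A a0 P p0} (f g : @PSec A a0 P p0) : Type :=
  PSec a0 (fun x => ev x f = ev x g) (projT2 f @ !(projT2 g)).

Definition happly_funext {fe : Funext} {A} {P : A -> Type} {f g : forall x, P x}
  (h : forall x, f x = g x) : happly (funext h) = h :=
  projT2 (snd (isequiv_happly A P f g)) h.

Definition psec_path {fe : Funext} {A a0 P p0} {f g : @PSec A a0 P p0}
  (h : PHtpy f g) : f = g :=
  path_PSec f g (funext (projT1 h))
    (ap (fun k => k a0) (happly_funext (projT1 h)) @ projT2 h).

Lemma ap_ev_psec_path {fe : Funext} {A a0 P p0} {f g : @PSec A a0 P p0}
  (h : PHtpy f g) (y : A) : ap (ev y) (psec_path h) = projT1 h y.
Proof.
  exact (ap_ev_path_PSec _ _ _ _ y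
         @ ap (fun k => k y) (happly_funext (projT1 h))).
Defined.

Definition psec_htpy {A a0 P p0} {f g : @PSec A a0 P p0} (p : f = g) : PHtpy f g.
Proof.
  exists (fun y => ap (ev y) p). destruct p. simpl. exact (!(concat_pV _)).
Defined.

Definition psec_path' {fe : Funext} {A a0 P p0} {f g : @PSec A a0 P p0}
  (h : PHtpy f g) : f = g :=
  !(psec_path (psec_htpy (idpath (a := f)))) @ psec_path h.

Lemma psec_path'_htpy {fe : Funext} {A a0 P p0} {f g : @PSec A a0 P p0}
  (p : f = g) : psec_path' (psec_htpy p) = p.
Proof. destruct p. apply concat_Vp. Defined.

(* If [a0] is connected enough for sections over it to be determined by their
   value at [a0], pointed sections have a lower homotopy level. *)
Lemma hlevel_PSec {fe : Funext} {A} {a0 : A} (m : nat)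
  (conn : forall P : A -> Type, (forall x, hlevel m (P x)) ->
          forall p0 : P a0, PSec a0 P p0) (k : nat) :
  forall (P : A -> Type) (p0 : P a0),
    (forall x, hlevel (k + m) (P x)) -> hlevel k (PSec a0 P p0).
Proof.
  induction k as [|k IH]; intros P p0 h.
  - exists (conn P h p0). intros f. apply psec_path. apply conn.
    intros x. exact (hlevel_up (h x) _ _).
  - intros f g.
    apply (hlevel_retract k psec_htpy psec_path' psec_path'_htpy).
    apply IH. intros x. exact (h x _ _).
Defined.

Definition concat_p_Vp {A} {x y z : A} (q : x = y) : forall r : x = z, q @ (!q @ r) = r :=
  match q as q' in _ = t return forall r, q' @ (!q' @ r) = r with
  | idpath => fun r => concat_1p _ @ concat_1p _
  end.

Lemma ap_id {A} {x y : A} (p : x = y) : ap (fun t => t) p = p.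
Proof. destruct p; exact idpath. Defined.

Lemma translate_loop {A} {x y : A} (q : x = y) (d : q = q) :
  conj (concat_p_Vp q q) (ap (fun s => s @ (!q @ q)) d) = d.
Proof.
  destruct q; unfold conj; simpl. exact (concat_1p _ @ ap_id d).
Defined.

(* Pointed maps into a loop space are equal once they are pointwise equal. *)
Lemma loops_homogeneous {fe : Funext} {A} {a0 : A} {Z} {z : Z}
  (u v : @PSec A a0 (fun _ => z = z) idpath)
  (h : forall x, ev x u = ev x v) : u = v.
Proof.
  apply psec_path. destruct u as [u a], v as [v b]; unfold PHtpy, ev in *; simpl in *.
  pose (d := !(h a0) @ a @ !b : v a0 = v a0).
  exists (fun x => h x @ conj (concat_p_Vp (v a0) (v x))
                            (ap (fun q => q @ (!(v a0) @ v x)) d)).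
  refine (ap (fun r => h a0 @ r) (translate_loop (v a0) d) @ _).
  unfold d. refine (concat_pp _ _ _ @ _). refine (ap (fun r => r @ !b) _).
  refine (concat_pp _ _ _ @ _).
  refine (ap (fun r => r @ a) (concat_pV _) @ _). apply concat_1p.
Defined.

(** * Recursion principles *)

Section Recursors.
Context {hits : HITs}.

Lemma Susp_ind_beta {A} {P : Susp A -> Type} (n : P north) (s : P south)
  (m : forall a, DPath P (merid a) n s)
  (f := projT1 (Susp_ind A P (existT _ n (existT _ s m)))) : f north = n.
Proof.
  exact (ap (fun d => projT1 d) (projT2 (Susp_ind A P (existT _ n (existT _ s m))))).
Defined.

Definition Susp_rec {A X} (n s : X) (m : A -> n = s) : Susp A -> X :=
  projT1 (Susp_ind A (fun _ => X)
    (existT _ n (existT _ s (fun a => transport_const (merid a) n @ m a)))).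

Definition Susp_rec_beta {A X} (n s : X) (m : A -> n = s) :
  {bn : Susp_rec n s m north = n & {bs : Susp_rec n s m south = s &
    forall a, !bn @ ap (Susp_rec n s m) (merid a) @ bs = m a}}.
Proof.
  unfold Susp_rec.
  destruct (Susp_ind _ _ _) as [f e]; simpl.
  assert (gen : forall d : SuspData (@merid hits A) (fun _ => X),
     SuspRestr (@merid _ A) f = d ->
     {bn : f north = projT1 d & {bs : f south = projT1 (projT2 d) &
        forall a, !bn @ ap f (merid a) @ bs =
          !(transport_const (merid a) (projT1 d)) @ projT2 (projT2 d) a}}).
  { intros d ed; destruct ed; simpl. exists idpath. exists idpath. intros a.
    refine (concat_1p _ @ _).
    refine (_ @ !(ap (fun t => !(transport_const (merid a) (f north)) @ t)
                     (apD_const f (merid a)))).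
    refine (_ @ !(concat_pp _ _ _)).
    refine (_ @ !(ap (fun t => t @ ap f (merid a)) (concat_Vp _))).
    exact (!(concat_1p _)). }
  destruct (gen _ e) as [bn [bs bm]]; simpl in *.
  exists bn, bs. intros a. refine (bm a @ _).
  refine (concat_pp _ _ _ @ _).
  refine (ap (fun t => t @ m a) (concat_Vp _) @ concat_1p _).
Defined.

(* Transport of a loop in a constant family, against composition. *)
Lemma const_dconcat {X B} {x y z : X} {p : x = y} {q : y = z} {b c d : B}
  (r : b = c) (s : c = d) :
  dconcat (P := fun _ => B) (p := p) (q := q)
    (transport_const p b @ r) (transport_const q c @ s)
  = transport_const (p @ q) b @ (r @ s).
Proof.
  destruct s, r, q, p; exact idpath.
Defined.
Lemma const_DPath2 {X B} {x y : X} {p q : x = y} (h : p = q) {b c : B}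
  {r s : b = c} (k : r = s) :
  DPath (fun t => DPath (fun _ => B) t b c) h
    (transport_const p b @ r) (transport_const q b @ s).
Proof. destruct h, k; exact idpath. Defined.

Definition K1_rec {G : AbGroup} {X} (x : X) (l : G -> x = x)
  (c : forall g1 g2, l g1 @ l g2 = l (add g1 g2)) : K1 G -> X :=
  projT1 (K1_ind G (fun _ => X)
    (existT _ x (existT _ (fun g => transport_const (loop g) x @ l g)
      (fun g1 g2 =>
         ap (transport _ (loop_add g1 g2)) (const_dconcat (l g1) (l g2))
         @ const_DPath2 (loop_add g1 g2) (c g1 g2))))).

Definition K1_rec_beta {G : AbGroup} {X} (x : X) (l : G -> x = x)
  (c : forall g1 g2, l g1 @ l g2 = l (add g1 g2)) :
  {b : K1_rec x l c star = x &
    forall g, conj b (ap (K1_rec x l c) (loop g)) = l g}.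
Proof.
  unfold K1_rec.
  destruct (K1_ind _ _ _) as [f e]; simpl.
  assert (gen : forall d : K1Data (@loop_add hits G) (fun _ => X),
     K1Restr (@loop_add _ G) f = d ->
     {b : f star = projT1 d & forall g, conj b (ap f (loop g)) =
          !(transport_const (loop g) (projT1 d)) @ projT1 (projT2 d) g}).
  { intros d ed; destruct ed; simpl. exists idpath. intros g.
    refine (concat_1p _ @ _).
    refine (_ @ !(ap (fun t => !(transport_const (loop g) (f star)) @ t)
                     (apD_const f (loop g)))).
    refine (_ @ !(concat_pp _ _ _)).
    refine (_ @ !(ap (fun t => t @ ap f (loop g)) (concat_Vp _))).
    exact (!(concat_1p _)). }
  destruct (gen _ e) as [b bl]; simpl in *.
  exists b. intros g. refine (bl g @ _).
  refine (concat_pp _ _ _ @ _).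
  refine (ap (fun t => t @ l g) (concat_Vp _) @ concat_1p _).
Defined.

(** * Eilenberg-MacLane spaces *)

Fixpoint rawK (G : AbGroup) (n : nat) : Type :=
  match n with
  | 0 => G
  | S n' => match n' with 0 => K1 G | S _ => Susp (rawK G n') end
  end.

Definition raw0 {G : AbGroup} {n : nat} : rawK G n :=
  match n with
  | 0 => zero
  | S n' => match n' return rawK G (S n') with 0 => star | S _ => north end
  end.

Definition K (G : AbGroup) (n : nat) : Type :=
  match n with 0 => G | S _ => Trunc n (rawK G n) end.

Definition inK {G : AbGroup} {n : nat} : rawK G n -> K G n :=
  match n with 0 => fun g => g | S _ => tr end.

Definition K0 {G : AbGroup} {n : nat} : K G n := inK raw0.

Definition K_ntype (G : AbGroup) (n : nat) : IsNType n (K G n) :=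
  match n with
  | 0 => carrier_set G
  | S n' => Trunc_ntype (S n') (rawK G (S n'))
  end.

Definition K_ind {G : AbGroup} {n : nat} :
  forall {P : K G n -> Type}, (forall x, IsNType n (P x)) ->
  forall d : (forall a, P (inK a)), {f : forall x, P x & forall a, f (inK a) = d a} :=
  match n with
  | 0 => fun P _ d => existT _ d (fun _ => idpath)
  | S n' => fun P h d => Trunc_ind (S n') (rawK G (S n')) P h d
  end.

Definition K_rec {G : AbGroup} {n : nat} {X : Type} (h : IsNType n X)
  (f : rawK G n -> X) : K G n -> X := projT1 (K_ind (fun _ => h) f).
Definition K_rec_beta {G : AbGroup} {n : nat} {X : Type} (h : IsNType n X)
  (f : rawK G n -> X) : forall a, K_rec h f (inK a) = f a :=
  projT2 (K_ind (fun _ => h) f).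

(** ** Functorial action *)

Fixpoint rawK_map {G H : AbGroup} (phi : Hom G H) (n : nat) : rawK G n -> rawK H n :=
  match n with
  | 0 => phi
  | S n' =>
      match n' return (rawK G n' -> rawK H n') -> rawK G (S n') -> rawK H (S n') with
      | 0 => fun _ => K1_rec star (fun g => loop (phi g))
               (fun g1 g2 => loop_add (phi g1) (phi g2)
                             @ ap loop (!(hom_add G H phi g1 g2)))
      | S _ => fun phi_n' => Susp_rec north south (fun a => merid (phi_n' a))
      end (rawK_map phi n')
  end.

Definition K_map {G H : AbGroup} (phi : Hom G H) (n : nat) : K G n -> K H n :=
  K_rec (K_ntype H n) (fun x => inK (rawK_map phi n x)).

(** ** The maps [sigma] *)

Definition raw_sigma {G : AbGroup} {n : nat} :
  rawK G n -> @raw0 G (S n) = @raw0 G (S n) :=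
  match n with
  | 0 => loop
  | S n' => fun x : rawK G (S n') => merid x @ !(merid raw0)
  end.

Definition sigma {G : AbGroup} {n : nat} : K G n -> @K0 G (S n) = @K0 G (S n) :=
  K_rec (K_ntype G (S n) K0 K0) (fun x => ap inK (raw_sigma x)).

(** ** Negation *)

Lemma raw_neg_filler {G : AbGroup} (g1 g2 : G) :
  !(loop g1) @ !(loop g2) = !(loop (add g1 g2)).
Proof.
  refine (!(inv_pp _ _) @ ap inverse _).
  exact (loop_add g2 g1 @ ap loop (addC g2 g1)).
Defined.

Definition raw_neg {G : AbGroup} (n : nat) : rawK G n -> rawK G n :=
  match n with
  | 0 => opp
  | S n' =>
      match n' return rawK G (S n') -> rawK G (S n') with
      | 0 => K1_rec star (fun g => !(loop g)) raw_neg_filler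
      | S n'' => Susp_rec (A := rawK G (S n'')) north north
                   (fun a => !(merid a @ !(merid raw0)))
      end
  end.

Definition K_neg {G : AbGroup} {n : nat} : K G n -> K G n :=
  K_rec (K_ntype G n) (fun x => inK (raw_neg n x)).

(* [(-1)^p u] *)
Definition K_sign {G : AbGroup} {n : nat} (p : nat) (u : K G n) : K G n :=
  if Nat.even p then u else K_neg u.
End Recursors.

(** * Basepoints *)

Section CupProduct.
Context {fe : Funext} {hits : HITs}.

Lemma idem_idpath {A} {x : A} (p : x = x) (h : p @ p = p) : p = idpath.
Proof. exact (cancelL p p idpath h). Defined.

Lemma add_idem {G : AbGroup} (x : G) (h : add x x = x) : x = zero.
Proof.
  refine (!(add0 x) @ _).
  refine (ap (fun t => add t x) (!(addN x)) @ _).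
  refine (!(addA _ _ _) @ _).
  exact (ap (add (opp x)) h @ addN x).
Defined.

Lemma hom0 {G H : AbGroup} (phi : Hom G H) : phi zero = zero.
Proof.
  apply add_idem. exact (!(hom_add _ _ phi zero zero) @ ap phi (add0 zero)).
Defined.

Definition rawK_map0 {G H : AbGroup} (phi : Hom G H) (n : nat) :
  rawK_map phi n raw0 = raw0 :=
  match n with
  | 0 => hom0 phi
  | S n' => match n' return rawK_map phi (S n') raw0 = raw0 with
            | 0 => projT1 (K1_rec_beta star (fun g => loop (phi g)) _)
            | S n'' => projT1 (Susp_rec_beta north south
                                (fun a => merid (rawK_map phi (S n'') a)))
            end
  end.

Definition K_map0 {G H : AbGroup} (phi : Hom G H) (n : nat) :
  K_map phi n K0 = K0 :=
  K_rec_beta _ _ raw0 @ ap inK (rawK_map0 phi n).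

Lemma raw_sigma0 {G : AbGroup} (n : nat) : raw_sigma (@raw0 _ G n) = idpath.
Proof.
  destruct n as [|n]; simpl.
  - apply idem_idpath. exact (loop_add zero zero @ ap loop (add0 zero)).
  - apply concat_pV.
Defined.

Definition sigma0 {G : AbGroup} (n : nat) : sigma (@K0 _ G n) = idpath :=
  K_rec_beta _ _ raw0 @ ap (fun p => ap inK p) (raw_sigma0 n).

(** * Connectedness of Eilenberg-MacLane spaces *)

Lemma Susp_conn {A} (a0 : A) (k : nat)
  (conn : forall P : A -> Type, (forall x, hlevel k (P x)) ->
          forall p0 : P a0, PSec a0 P p0)
  (P : Susp A -> Type) (h : forall x, hlevel (S k) (P x)) (p0 : P north) :
  PSec north P p0.
Proof.
  pose (s := transport P (merid a0) p0).
  pose (m := conn (fun a => DPath P (merid a) p0 s) (fun _ => h _ _ _) idpath).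
  exists (projT1 (Susp_ind _ P (existT _ p0 (existT _ s (projT1 m))))).
  exact (Susp_ind_beta p0 s (projT1 m)).
Defined.

Lemma rawK_conn {G : AbGroup} (m : nat) : forall P : rawK G m -> Type,
  (forall x, hlevel m (P x)) -> forall p0 : P raw0, PSec raw0 P p0.
Proof.
  induction m as [|m IH]; intros P h p0.
  - exists (fun x => projT1 (h x)). apply (projT2 (h raw0)).
  - destruct m as [|m].
    + assert (d : K1Data (@loop_add _ G) P).
      { exists p0. exists (fun g => isprop_path (h star) _ _).
        intros g1 g2. apply isprop_path. exact (hlevel_up (h star) _ _). }
      exists (projT1 (K1_ind G P d)). apply (isprop_path (h star)).
    + exact (Susp_conn raw0 (S m) IH P h p0).
Defined.

Lemma K_conn {G : AbGroup} (m : nat) (P : K G m -> Type)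
  (h : forall x, hlevel m (P x)) (p0 : P K0) : PSec K0 P p0.
Proof.
  pose (s := rawK_conn m (fun x => P (inK x)) (fun x => h (inK x)) p0).
  pose (f := K_ind (P := P) (fun x => hlevel_le 2 (h x)) (projT1 s)).
  exists (projT1 f). exact (projT2 f raw0 @ projT2 s).
Defined.

Notation "A ->* B" := (PMap (A) K0 (B) K0) (at level 70).

Lemma PMap_ntype (G H : AbGroup) (n m : nat) :
  IsNType n (K G m ->* K H (n + m)).
Proof.
  apply (hlevel_PSec m (K_conn m)). intros _. exact (K_ntype H (n + m)).
Defined.

(** * Pointed maps out of Eilenberg-MacLane spaces *)

Lemma unwhisker {A} {x y x' y' : A} (p : x = y) (b : x = x') (c : y = y') :
  p = b @ (!b @ p @ c) @ !c.
Proof. destruct c, b; simpl. exact (!(concat_1p _ @ concat_1p _)). Defined.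
Lemma conj_whisker {A} {x y x' y' : A} (p q : x = y) (b : x' = x) (c : y' = y) :
  conj b ((b @ p @ !c) @ !(b @ q @ !c)) = p @ !q.
Proof.
  destruct c, b; unfold conj; simpl.
  exact (concat_1p _ @ concat2 (concat_1p _) (ap inverse (concat_1p _))).
Defined.

Lemma ap_sigma_map {G H : AbGroup} (phi : Hom G H) (n : nat) (x : rawK G n) :
  conj (rawK_map0 phi (S n)) (ap (rawK_map phi (S n)) (raw_sigma x))
  = raw_sigma (rawK_map phi n x).
Proof.
  destruct n as [|n].
  - exact (projT2 (K1_rec_beta star (fun g => loop (phi g)) _) x).
  - change (rawK_map phi (S (S n))) with
      (Susp_rec north south (fun a => merid (rawK_map phi (S n) a))).
    change (rawK_map0 phi (S (S n))) with
      (projT1 (Susp_rec_beta north south (fun a => merid (rawK_map phi (S n) a)))).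
    destruct (Susp_rec_beta _ _ _) as [bn [bs bm]].
    generalize dependent (Susp_rec north south
                            (fun a => merid (rawK_map phi (S n) a))).
    intros f bn bs bm. cbn [projT1].
    assert (e : forall a, ap f (merid a) = bn @ merid (rawK_map phi (S n) a) @ !bs).
    { intros a. exact (unwhisker _ bn bs @ ap (fun t => bn @ t @ !bs) (bm a)). }
    cbn [raw_sigma].
    refine (ap (conj bn) (ap_pp _ _ _ @ ap (fun t => _ @ t) (ap_V f _)
             @ concat2 (e x) (ap inverse (e raw0))) @ _).
    refine (conj_whisker _ _ bn bs @ _).
    exact (ap (fun t => merid (rawK_map phi (S n) x) @ !(merid t))
             (rawK_map0 phi (S n))).
Defined.

Lemma ap_homotopic {A B} {f g : A -> B} (h : forall x, f x = g x) {x : A} (p : x = x) :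
  conj (h x) (ap f p) = ap g p.
Proof.
  assert (k : forall (y : A) (q : x = y), !(h x) @ ap f q @ h y = ap g q).
  { intros y q; destruct q. apply concat_Vp. }
  exact (k x p).
Defined.

Lemma sigma_natural {G H : AbGroup} (phi : Hom G H) (n : nat) (x : rawK G n) :
  conj (K_map0 phi (S n)) (ap (K_map phi (S n)) (sigma (inK x)))
  = sigma (K_map phi n (inK x)).
Proof.
  unfold sigma at 1.
  refine (ap (fun t => conj _ (ap _ t)) (K_rec_beta _ _ x) @ _).
  unfold K_map0.
  refine (conj_conj _ _ _ @ _).
  refine (ap (conj _) (ap (conj _) (!(ap_comp (K_map phi (S n)) inK _))) @ _).
  refine (ap (conj _) (ap_homotopic (f := fun x => K_map phi (S n) (inK x))
            (g := fun x => inK (rawK_map phi (S n) x)) (K_rec_beta _ _) _) @ _).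
  refine (ap (conj _) (ap_comp inK (rawK_map phi (S n)) _) @ _).
  refine (!(conj_ap inK _ _) @ _).
  refine (ap (fun t => ap inK t) (ap_sigma_map phi n x) @ _).
  refine (!_).
  refine (ap sigma (K_rec_beta _ _ x) @ _).
  exact (K_rec_beta _ _ _).
Defined.

Lemma sigma_inK {G : AbGroup} {n : nat} (x : rawK G n) :
  sigma (inK x) = ap inK (raw_sigma x).
Proof. exact (K_rec_beta _ _ x). Defined.

Lemma conj_square {A} {x y : A} (a : x = y) (p : x = x) (q : y = y)
  (h : conj a p = q) : a @ q = p @ a.
Proof.
  destruct h, a; unfold conj; simpl. exact (concat_1p _ @ concat_1p _).
Defined.
Lemma conj_square2 {A} {x y x' y' : A} (a : x = y) (p p0 : x = x') (q q0 : y = y')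
  (h : conj a (p @ !p0) = q @ !q0) : a @ q = p @ (!p0 @ a @ q0).
Proof.
  destruct p0, q0. exact (conj_square a p q h @ ap (fun t => p @ t) (!(concat_1p a))).
Defined.

Lemma fun_ext_Susp {A} (a0 : A) {Z : Type} (f f' : Susp A -> Z)
  (a : f north = f' north)
  (h : forall x, conj a (ap f (merid x @ !(merid a0)))
                 = ap f' (merid x @ !(merid a0))) :
  forall y, f y = f' y.
Proof.
  assert (d : SuspData (@merid _ A) (fun y => f y = f' y)).
  { exists a. exists (!(ap f (merid a0)) @ a @ ap f' (merid a0)).
    intros x. apply transport_paths. apply conj_square2.
    refine (ap (conj a) (ap (fun t => _ @ t) (!(ap_V f _)) @ !(ap_pp f _ _)) @ _).
    refine (h x @ _).
    exact (ap_pp f' _ _ @ ap (fun t => _ @ t) (ap_V f' _)). }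
  exact (projT1 (Susp_ind _ _ d)).
Defined.

Lemma fun_ext_rawK {G : AbGroup} (m : nat) {Z : Type} (hZ : hlevel (S (S (S m))) Z)
  (f f' : rawK G (S m) -> Z) (a : f raw0 = f' raw0)
  (h : forall x : rawK G m, conj a (ap f (raw_sigma x)) = ap f' (raw_sigma x)) :
  forall y, f y = f' y.
Proof.
  destruct m as [|m].
  - assert (d : K1Data (@loop_add _ G) (fun y => f y = f' y)).
    { exists a.
      exists (fun g => transport_paths f f' (loop g) a a (conj_square _ _ _ (h g))).
      intros g1 g2. apply isprop_path. exact (hZ _ _ _ _). }
    exact (projT1 (K1_ind G _ d)).
  - exact (fun_ext_Susp (A := rawK G (S m)) raw0 f f' a h).
Defined.

Lemma fun_ext_K {G : AbGroup} (m : nat) {Z : Type} (hZ : hlevel (S (S (S m))) Z)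
  (F F' : K G (S m) -> Z) (a : F K0 = F' K0)
  (h : forall x : rawK G m, conj a (ap F (sigma (inK x))) = ap F' (sigma (inK x))) :
  forall y, F y = F' y.
Proof.
  refine (projT1 (K_ind (n := S m) (P := fun y => F y = F' y)
            (fun y => hlevel_up hZ _ _) _)).
  refine (fun_ext_rawK m hZ (fun y => F (inK y)) (fun y => F' (inK y)) a _).
  intros x.
  refine (ap (conj a) (ap_comp F inK _) @ _ @ !(ap_comp F' inK _)).
  exact (ap (fun t => conj a (ap F t)) (!(sigma_inK x)) @ h x
         @ ap (fun t => ap F' t) (sigma_inK x)).
Defined.

(** * Additivity of maps into loop spaces *)

Lemma ap_1p {A} {x y : A} {b b' : x = y} (q : b = b') :
  ap (fun t => idpath @ t) q = concat_1p b @ q @ !(concat_1p b').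
Proof. destruct q. exact (!(concat_pV _)). Defined.

Lemma loops_mul_aux {Z} {z : Z} {a b : z = z} (d1 : idpath = a) (d2 : idpath = b)
  (q1 : a = a) (q2 : b = b) :
  conj (concat2 (!d1) (!d2)) (concat2 q1 q2) = conj (!d1) q1 @ conj (!d2) q2.
Proof.
  destruct d1, d2; unfold conj, concat2; simpl.
  refine (concat_1p _ @ _).
  refine (concat2 (ap_id q1 @ !(concat_1p q1)) (ap_1p q2)).
Defined.

Lemma inv_V {A} {x y : A} (p : x = y) : !(!p) = p.
Proof. destruct p; exact idpath. Defined.

(* Horizontal and vertical composition of 2-loops agree. *)
Lemma ap_loops_mul {A Z} {z : Z} (f1 f2 : A -> z = z) {x : A} (p : x = x)
  (e1 : f1 x = idpath) (e2 : f2 x = idpath) :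
  conj (concat2 e1 e2) (ap (fun y => f1 y @ f2 y) p)
  = conj e1 (ap f1 p) @ conj e2 (ap f2 p).
Proof.
  assert (k : forall (y : A) (q : x = y), ap (fun y => f1 y @ f2 y) q
                = concat2 (ap f1 q) (ap f2 q)).
  { intros y q; destruct q; exact idpath. }
  refine (ap (conj _) (k x p) @ _).
  pose (l := loops_mul_aux (!e1) (!e2) (ap f1 p) (ap f2 p)).
  rewrite (inv_V e1), (inv_V e2) in l. exact l.
Defined.

Lemma sigma_add {G : AbGroup} (g1 g2 : G) :
  sigma (n := 0) g1 @ sigma (n := 0) g2 = sigma (n := 0) (add g1 g2).
Proof.
  exact (!(ap_pp tr (loop g1) (loop g2)) @ ap (fun t => ap tr t) (loop_add g1 g2)).
Defined.

Lemma loop_map_add {m : nat} : forall {G H : AbGroup} {Z : Type} (z : Z)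
  (hZ : IsNType m (z = z)) (s : K H m -> z = z) (b : s K0 = idpath)
  (hs : match m return (K H m -> z = z) -> Type with
        | 0 => fun s => forall h1 h2, s h1 @ s h2 = s (add h1 h2)
        | S _ => fun _ => unit
        end s)
  (phi1 phi2 phi3 : Hom G H) (e : forall g, phi3 g = add (phi1 g) (phi2 g))
  (y : K G m), s (K_map phi1 m y) @ s (K_map phi2 m y) = s (K_map phi3 m y).
Proof.
  induction m as [|m IH]; intros.
  - exact (hs _ _ @ ap s (!(e y))).
  - revert y.
    pose (ept := fun phi : Hom G H => ap s (K_map0 phi (S m)) @ b).
    pose (s' := fun y : K H m => conj b (ap s (sigma y)) : @idpath _ z = idpath).
    assert (nat : forall (phi : Hom G H) (x : rawK G m),
       conj (ept phi) (ap (fun y => s (K_map phi (S m) y)) (sigma (inK x)))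
       = s' (K_map phi m (inK x))).
    { intros phi x. unfold ept, s'.
      refine (conj_conj _ _ _ @ ap (conj b) _).
      refine (ap (conj _) (ap_comp s (K_map phi (S m)) _) @ !(conj_ap s _ _) @ _).
      exact (ap (fun t => ap s t) (sigma_natural phi m x)). }
    refine (fun_ext_K m hZ _ _ (concat2 (ept phi1) (ept phi2) @ !(ept phi3)) _).
    intros x.
    refine (conj_conj _ _ _ @ _).
    refine (!(conj_eq _ _ _ _)).
    refine (nat phi3 x @ _).
    refine (_ @ !(ap_loops_mul _ _ _ (ept phi1) (ept phi2))).
    refine (_ @ !(concat2 (nat phi1 x) (nat phi2 x))).
    refine (!(IH G H (z = z) idpath (hZ _ _) s' _ _ phi1 phi2 phi3 e (inK x))).
    + exact (ap (fun t => conj b (ap s t)) (sigma0 m) @ conj_idpath b).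
    + destruct m as [|m]; [|exact tt]. intros h1 h2. unfold s'.
      refine (conj_pp _ _ _ @ ap (conj b) (!(ap_pp s _ _) @ ap (fun t => ap s t) _)).
      exact (sigma_add h1 h2).
Defined.

(** * The cup product *)

Definition PMap_const {A : Type} {a0 : A} {B : Type} {b0 : B} : PMap A a0 B b0 :=
  existT _ (fun _ => b0) idpath.

(* The loop at the constant map given by a pointed map into a loop space. *)
Definition PMap_loop {A : Type} {a0 : A} {B : Type} {b0 : B}
  (s : A -> b0 = b0) (s0 : s a0 = idpath)
  : @PMap_const A a0 B b0 = PMap_const :=
  psec_path (f := PMap_const) (g := PMap_const) (existT _ s s0).

Lemma ap_ev_PMap_loop {A : Type} {a0 : A} {B : Type} {b0 : B}
  (s : A -> b0 = b0) (s0 : s a0 = idpath) (y : A) :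
  ap (ev y) (PMap_loop s s0) = s y.
Proof. exact (ap_ev_psec_path _ y). Defined.

Lemma PMap_loop_ext {A : Type} {a0 : A} {B : Type} {b0 : B}
  (p q : @PMap_const A a0 B b0 = PMap_const)
  (h : forall y, ap (ev y) p = ap (ev y) q) : p = q.
Proof.
  refine (!(psec_path'_htpy p) @ ap psec_path' _ @ psec_path'_htpy q).
  exact (loops_homogeneous (psec_htpy p) (psec_htpy q) h).
Defined.

(* [g (x) -] *)
Definition tens_hom {G1 G2 : AbGroup} (g : G1) : Hom G2 (Tensor G1 G2) :=
  mkHom G2 (Tensor G1 G2) (tens g) (snd (tens_bilinear G1 G2) g).

Definition cup0 {G1 G2 : AbGroup} {m : nat} (g : G1)
  : K G2 m ->* K (Tensor G1 G2) m :=
  existT _ (K_map (tens_hom g) m) (K_map0 (tens_hom g) m).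

(* [fun y => sigma (f y)], as a loop at the constant map. *)
Definition cup_loop {G H : AbGroup} {m k : nat} (f : K G m ->* K H k)
  : @PMap_const _ (@K0 _ G m) _ (@K0 _ H (S k)) = PMap_const :=
  PMap_loop (fun y => sigma (ev y f)) (ap sigma (projT2 f) @ sigma0 k).

Lemma cup_filler {G1 G2 : AbGroup} {m : nat} (g1 g2 : G1) :
  cup_loop (@cup0 G1 G2 m g1) @ cup_loop (cup0 g2) = cup_loop (cup0 (add g1 g2)).
Proof.
  apply PMap_loop_ext. intros y.
  refine (ap_pp _ _ _ @ _).
  refine (concat2 (ap_ev_PMap_loop _ _ y) (ap_ev_PMap_loop _ _ y) @ _).
  refine (_ @ !(ap_ev_PMap_loop _ _ y)).
  refine (loop_map_add K0 (K_ntype (Tensor G1 G2) (S m) _ _) sigma (sigma0 m) _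
            (tens_hom g1) (tens_hom g2) (tens_hom (add g1 g2))
            (fst (tens_bilinear G1 G2) g1 g2) y).
  destruct m as [|m]; [exact sigma_add|exact tt].
Defined.

Fixpoint raw_cup {G1 G2 : AbGroup} (n m : nat)
  : rawK G1 n -> (K G2 m ->* K (Tensor G1 G2) (n + m)) :=
  match n with
  | 0 => cup0
  | S n' =>
      match n' return
        (rawK G1 n' -> (K G2 m ->* K (Tensor G1 G2) (n' + m))) ->
        rawK G1 (S n') -> (K G2 m ->* K (Tensor G1 G2) (S n' + m)) with
      | 0 => fun _ => K1_rec PMap_const (fun g => cup_loop (cup0 g)) cup_filler
      | S _ => fun cup_n' => Susp_rec PMap_const PMap_const
                               (fun a => cup_loop (cup_n' a))
      end (raw_cup n' m)
  end.

Definition cupP {G1 G2 : AbGroup} {n m : nat}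
  : K G1 n -> (K G2 m ->* K (Tensor G1 G2) (n + m)) :=
  K_rec (PMap_ntype G2 (Tensor G1 G2) n m) (raw_cup n m).

Definition cup {G1 G2 : AbGroup} {n m : nat} (x : K G1 n) (y : K G2 m)
  : K (Tensor G1 G2) (n + m) := ev y (cupP x).

(** * The comparison map *)

Lemma swap_bilinear (G1 G2 : AbGroup) :
  Bilinear (fun (y : G2) (x : G1) => tens x y).
Proof.
  split.
  - intros y y' x. exact (snd (tens_bilinear G1 G2) x y y').
  - intros y x x'. exact (fst (tens_bilinear G1 G2) x x' y).
Defined.

(* The homomorphism [y (x) x |-> x (x) y]. *)
Definition tensor_swap (G1 G2 : AbGroup) : Hom (Tensor G2 G1) (Tensor G1 G2) :=
  projT1 (projT1 (Tensor_univ G2 G1 (Tensor G1 G2) _ (swap_bilinear G1 G2))).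

Definition tensor_swap_tens {G1 G2 : AbGroup} (y : G2) (x : G1) :
  tensor_swap G1 G2 (tens y x) = tens x y :=
  projT2 (projT1 (Tensor_univ G2 G1 (Tensor G1 G2) _ (swap_bilinear G1 G2))) y x.

Fixpoint addn_S (m n : nat) : m + S n = S (m + n) :=
  match m with 0 => idpath | S m' => ap S (addn_S m' n) end.
Fixpoint addn_0 (n : nat) : n + 0 = n :=
  match n with 0 => idpath | S n' => ap S (addn_0 n') end.
Fixpoint addn_comm (m n : nat) : m + n = n + m :=
  match m with
  | 0 => !(addn_0 n)
  | S m' => ap S (addn_comm m' n) @ !(addn_S n m')
  end.

Definition K_swap {G1 G2 : AbGroup} {m n : nat} (u : K (Tensor G2 G1) (m + n))
  : K (Tensor G1 G2) (n + m) :=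
  transport (K (Tensor G1 G2)) (addn_comm m n) (K_map (tensor_swap G1 G2) (m + n) u).

Lemma sigma_natural' {G H : AbGroup} (phi : Hom G H) (n : nat) (x : K G n) :
  conj (K_map0 phi (S n)) (ap (K_map phi (S n)) (sigma x)) = sigma (K_map phi n x).
Proof.
  revert x. refine (projT1 (K_ind (fun x => _) (sigma_natural phi n))).
  exact (hlevel_up (k := S (S n)) (A := @K0 _ H (S n) = K0)
                     (K_ntype H (S n) _ _) _ _).
Defined.

Lemma K_map_cancel {G H : AbGroup} (phi : Hom G H) (psi : Hom H G)
  (e : forall g, psi (phi g) = g) (n : nat) :
  forall x, K_map psi n (K_map phi n x) = x.
Proof.
  induction n as [|n IH]; [exact e|].
  refine (fun_ext_K n (K_ntype G (S n)) (fun x => K_map psi (S n) (K_map phi (S n) x))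
            (fun x => x) (ap (K_map psi (S n)) (K_map0 phi (S n)) @ K_map0 psi (S n)) _).
  intros x.
  refine (conj_conj _ _ _ @ _ @ !(ap_id _)).
  refine (ap (conj _) (ap (conj _) (ap_comp (K_map psi (S n)) (K_map phi (S n)) _)
                       @ !(conj_ap _ _ _)) @ _).
  refine (ap (fun t => conj _ (ap _ t)) (sigma_natural' phi n (inK x)) @ _).
  exact (sigma_natural' psi n _ @ ap sigma (IH (inK x))).
Defined.

Definition hom_id (G : AbGroup) : Hom G G :=
  mkHom G G (fun x => x) (fun _ _ => idpath).
Definition hom_comp {G H L : AbGroup} (psi : Hom H L) (phi : Hom G H) : Hom G L :=
  mkHom G L (fun x => psi (phi x))
    (fun x y => ap psi (hom_add _ _ phi x y) @ hom_add _ _ psi (phi x) (phi y)).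

Lemma tensor_swapK (G1 G2 : AbGroup) (t : Tensor G2 G1) :
  tensor_swap G2 G1 (tensor_swap G1 G2 t) = t.
Proof.
  pose (u := contr_path (Tensor_univ G2 G1 _ _ (tens_bilinear G2 G1))
    (existT _ (hom_comp (tensor_swap G2 G1) (tensor_swap G1 G2))
       (fun x y => ap (tensor_swap G2 G1) (tensor_swap_tens x y)
                   @ tensor_swap_tens y x))
    (existT _ (hom_id _) (fun _ _ => idpath))).
  exact (ap (fun f => hom_fun _ _ (projT1 f) t) u).
Defined.

Lemma K_swap_isequiv (G1 G2 : AbGroup) (m n : nat) : IsEquiv (@K_swap G1 G2 m n).
Proof.
  unfold IsEquiv, K_swap. destruct (addn_comm m n); simpl.
  split; exists (K_map (tensor_swap G2 G1) (m + n));
    apply K_map_cancel; apply tensor_swapK.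
Defined.
End CupProduct.

(* Main.v *)
(* A map out of [K G (S n)] is determined by its effect on the loops [sigma x].
   In degrees [(S n, S m)] apply this in both variables: it suffices to compare
   the two sides after looping once in each variable.  Looping [cup] in its first
   variable gives [sigma (cup x Y)]; the induction hypothesis at [(n, S m)] turns
   this into a cup product in the other order, which can be looped in [Y].  The
   other side is easy to loop first in [Y] and then, by the hypothesis at
   [(S n, m)], in [X].  The two orders of looping give inverse elements of the
   double loop space, which is the source of the sign; the hypothesis at [(n, m)]
   concludes. *)

Require Import Defs.
From Stdlib Require Import PeanoNat.

Local Notation "x = y" := (paths x y) : type_scope.

(** * Eckmann-Hilton *)

Lemma concat_p1_natural {A} {x : A} {p q : x = x} (h : p = q) :
  ap (fun t => t @ idpath) h = h.
Proof. destruct h; exact idpath. Defined.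

Lemma concat2_swap {A} {x y z : A} {p p' : x = y} {q q' : y = z}
  (h : p = p') (k : q = q') :
  ap (fun t => t @ q) h @ ap (fun t => p' @ t) k
  = ap (fun t => p @ t) k @ ap (fun t => t @ q') h.
Proof. destruct h, k; exact idpath. Defined.

(** Whiskering a 2-loop by [idpath] on either side gives it back, so the interchange law
    [concat2_swap] becomes commutativity. *)
Lemma loop2_comm {A} {x : A} (h k : @idpath A x = idpath) : h @ k = k @ h.
Proof.
  assert (e : forall l : @idpath A x = idpath, ap (fun t => idpath @ t) l = l).
  { intros l. exact (ap_1p l @ concat_1p l). }
  exact (concat2 (!(concat_p1_natural h)) (!(e k)) @ concat2_swap h k
         @ concat2 (e k) (concat_p1_natural h)).
Defined.

Lemma conj_loop2 {A} {x : A} (h k : @idpath A x = idpath) : conj h k = k.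
Proof.
  unfold conj. rewrite <- concat_pp, (loop2_comm k h), concat_pp, concat_Vp.
  apply concat_1p.
Defined.

(** Two trivialisations of [w] differ by a 2-loop at [idpath], and conjugation by such a 2-loop is
    trivial. Hence basepoint trivialisations can be chosen freely in all comparisons of double loops
    below. *)
Lemma conj_loop2_indep {A} {x : A} {w : x = x} (s s' : w = idpath) (v : w = w) :
  conj s v = conj s' v.
Proof.
  rewrite <- (conj_loop2 (!s @ s') (conj s v)), <- conj_conj.
  rewrite concat_p_Vp. exact idpath.
Defined.

Lemma ap_loop2_homotopic {A Z} {z : Z} {h h' : A -> z = z} (k : forall a, h a = h' a)
  {a : A} (p : a = a) (s : h a = idpath) (s' : h' a = idpath) :
  conj s (ap h p) = conj s' (ap h' p).
Proof.
  rewrite <- (ap_homotopic k p), <- conj_conj. apply conj_loop2_indep.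
Defined.

Lemma ap_const {A Z} (z : Z) {x y : A} (p : x = y) : ap (fun _ => z) p = idpath.
Proof. destruct p; exact idpath. Defined.

Lemma path_of_concat_pV {A} {x y : A} (p q : x = y) (h : p @ !q = idpath) : p = q.
Proof. destruct q. exact h. Defined.

(** The pointwise product of [!h] and [h] is constant, and [ap_loops_mul] turns that product into
    composition of 2-loops. *)
Lemma ap_loop2_inverse {A Z} {z : Z} (h : A -> z = z) {a : A} (p : a = a)
  (s : h a = idpath) (s' : !(h a) = idpath) :
  conj s' (ap (fun t => !(h t)) p) = !(conj s (ap h p)).
Proof.
  apply path_of_concat_pV. rewrite inv_V.
  rewrite <- (ap_loops_mul (fun t => !(h t)) h p s' s).
  rewrite (ap_loop2_homotopic (h' := fun _ => idpath) (fun t => concat_Vp (h t))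
             p _ idpath).
  rewrite ap_const. exact idpath.
Defined.

(** * Maps pointed in each of two variables *)

(** These data amount to a pointed map out of the smash product of [A] and [B]: a map on the
    product, trivialised on both axes, coherently at their common point. *)
Record Bimap {A : Type} (a0 : A) {B : Type} (b0 : B) {Z : Type} (z0 : Z) := mkBimap {
  bi_fun :> A -> B -> Z;
  bi_l : forall b, bi_fun a0 b = z0;
  bi_r : forall a, bi_fun a b0 = z0;
  bi_c : bi_l b0 = bi_r a0
}.
Arguments mkBimap {A a0 B b0 Z z0}.
Arguments bi_fun {A a0 B b0 Z z0}.
Arguments bi_l {A a0 B b0 Z z0}.
Arguments bi_r {A a0 B b0 Z z0}.
Arguments bi_c {A a0 B b0 Z z0}.

Definition bi_flip {A a0 B b0 Z z0} (F : @Bimap A a0 B b0 Z z0) : Bimap b0 a0 z0 :=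
  mkBimap (fun b a => F a b) (bi_r F) (bi_l F) (!(bi_c F)).

Definition bi_comp {A a0 B b0 Z z0 W} {w0 : W} (phi : Z -> W) (phi0 : phi z0 = w0)
  (F : @Bimap A a0 B b0 Z z0) : Bimap a0 b0 w0 :=
  mkBimap (fun a b => phi (F a b)) (fun b => ap phi (bi_l F b) @ phi0)
    (fun a => ap phi (bi_r F a) @ phi0)
    (ap (fun t => ap phi t @ phi0) (bi_c F)).

(* Coherence at the pair of basepoints can always be forced by correcting one of
   the two families of trivialisations. *)
Definition bi_coherent {A} {a0 : A} {B} {b0 : B} {Z} {z0 : Z} (f : A -> B -> Z)
  (l : forall b, f a0 b = z0) (r : forall a, f a b0 = z0) : Bimap a0 b0 z0.
Proof.
  refine (mkBimap f l (fun a => r a @ (!(r a0) @ l b0)) _).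
  exact (!(concat_p_Vp (r a0) (l b0))).
Defined.

Definition loopl {A a0 B b0 Z z0} (F : @Bimap A a0 B b0 Z z0) (p : a0 = a0) (b : B)
  : z0 = z0 := conj (bi_l F b) (ap (fun a => F a b) p).

Lemma loopl_comp {A a0 B b0 Z z0 W} {w0 : W} (phi : Z -> W) (phi0 : phi z0 = w0)
  (F : @Bimap A a0 B b0 Z z0) (p : a0 = a0) (b : B) :
  loopl (bi_comp phi phi0 F) p b = conj phi0 (ap phi (loopl F p b)).
Proof.
  unfold loopl; simpl.
  rewrite conj_conj, conj_ap, (ap_comp phi (fun a => F a b)). exact idpath.
Defined.

Lemma loopl_flip_flip {A a0 B b0 Z z0} (F : @Bimap A a0 B b0 Z z0) (p : a0 = a0) (b : B) :
  loopl (bi_flip (bi_flip F)) p b = loopl F p b.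
Proof. exact idpath. Defined.

Definition loop_side {A Z} (f : A -> Z) {z : Z} (h : forall a, f a = z) {a a' : A}
  (p : a = a') (u : f a = z) (v : f a' = z) (cu : u = h a) (cv : v = h a')
  : !u @ ap f p @ v = idpath.
Proof.
  destruct p. exact (concat2 (ap inverse cu) cv @ concat_Vp (h a)).
Defined.

(* Both sides measure the filler of the square with sides [p] and [q], traversed in
   the two directions; with free endpoints this follows by path induction. *)
Lemma square_transpose {A B Z} (F : A -> B -> Z) {z : Z} {a0 a1 : A} {b0 b1 : B}
  (p : a0 = a1) (q : b0 = b1)
  (l0 : forall b, F a0 b = z) (l1 : forall b, F a1 b = z)
  (r0 : forall a, F a b0 = z) (r1 : forall a, F a b1 = z)
  (c00 : l0 b0 = r0 a0) (c01 : l0 b1 = r1 a0)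
  (c10 : l1 b0 = r0 a1) (c11 : l1 b1 = r1 a1) :
  !(loop_side (fun a => F a b0) r0 p (l0 b0) (l1 b0) c00 c10)
   @ ap (fun b => !(l0 b) @ ap (fun a => F a b) p @ l1 b) q
   @ loop_side (fun a => F a b1) r1 p (l0 b1) (l1 b1) c01 c11
  = !(!(loop_side (fun b => F a0 b) l0 q (r0 a0) (r1 a0) (!c00) (!c01))
      @ ap (fun a => !(r0 a) @ ap (fun b => F a b) q @ r1 a) p
      @ loop_side (fun b => F a1 b) l1 q (r0 a1) (r1 a1) (!c10) (!c11)).
Proof.
  destruct p, q; unfold loop_side; simpl.
  generalize dependent (r1 a0). generalize dependent (r0 a0).
  generalize dependent (l1 b0). generalize dependent (l0 b0).
  clear l0 l1 r0 r1. intros l0 l1 r0 c00 c10 r1 c01 c11.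
  (* The four coherences form a cycle. Contracting three of them leaves a single 2-loop [c11]; the
     left side reduces to [c11] and the right side to its double inverse. *)
  destruct c00, c01, c10, l1. simpl.
  assert (e : forall c : @idpath _ (F a0 b0) = idpath,
            idpath @ concat2 (@idpath _ (@idpath _ (F a0 b0))) c = c).
  { intros c. exact (concat_1p _ @ concat_1p _ @ ap_1p c @ concat_1p c). }
  exact (e c11 @ !(inv_V c11) @ ap inverse (!(e (!c11)))).
Defined.

(** Exchanging the order of the two loopings inverts the double loop; this is the sign contributed
    by one swap of loop coordinates. *)
Lemma loopl_transpose {A a0 B b0 Z z0} (F : @Bimap A a0 B b0 Z z0)
  (p : a0 = a0) (q : b0 = b0)
  (s : loopl F p b0 = idpath) (t : loopl (bi_flip F) q a0 = idpath) :
  conj s (ap (loopl F p) q) = !(conj t (ap (loopl (bi_flip F) q) p)).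
Proof.
  pose (e := square_transpose F p q (bi_l F) (bi_l F) (bi_r F) (bi_r F)
               (bi_c F) (bi_c F) (bi_c F) (bi_c F)).
  exact (conj_loop2_indep _ _ _ @ e @ ap inverse (conj_loop2_indep _ _ _)).
Defined.

Lemma loopl_basepoint {A a0 B b0 Z z0} (F : @Bimap A a0 B b0 Z z0) (p : a0 = a0) :
  loopl F p b0 = idpath.
Proof.
  exact (loop_side (fun a => F a b0) (bi_r F) p _ _ (bi_c F) (bi_c F)).
Defined.

Lemma loopl_idpath {A a0 B b0 Z z0} (F : @Bimap A a0 B b0 Z z0) (p : a0 = a0)
  (h : p = idpath) (b : B) : loopl F p b = idpath.
Proof. unfold loopl. rewrite h. apply conj_idpath. Defined.

(** * The natural numbers form a set *)

Fixpoint nat_code (m n : nat) : Type :=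
  match m, n with
  | 0, 0 => unit
  | S m', S n' => nat_code m' n'
  | _, _ => Empty_set
  end.

Lemma nat_code_prop (m n : nat) : IsProp (nat_code m n).
Proof.
  revert n; induction m as [|m IH]; intros [|n]; simpl.
  - apply (hlevel_up (k := 0)). exists tt. intros []. exact idpath.
  - intros [].
  - intros [].
  - apply IH.
Defined.

Fixpoint nat_encode_refl (n : nat) : nat_code n n :=
  match n with 0 => tt | S n' => nat_encode_refl n' end.

Fixpoint nat_decode (m n : nat) : nat_code m n -> m = n :=
  match m, n return nat_code m n -> m = n with
  | 0, 0 => fun _ => idpath
  | S m', S n' => fun c => ap S (nat_decode m' n' c)
  | 0, S _ | S _, 0 => fun c => match c with end
  end.

Lemma nat_set : IsSet nat.
Proof.
  (* Encoding and decoding exhibit [m = n] as a retract of the proposition [nat_code m n]. *)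
  intros m n. apply (hlevel_retract 1
    (fun p : m = n => transport (nat_code m) p (nat_encode_refl m)) (nat_decode m n)).
  - intros p; destruct p; simpl. induction m as [|m IH]; simpl; [exact idpath|].
    exact (ap (ap S) IH).
  - apply nat_code_prop.
Defined.

Lemma nat_path_prop {m n : nat} (p q : m = n) : p = q.
Proof. exact (isprop_path (nat_set m n) p q). Defined.

Section GradedCommutativity.
Context {fe : Funext} {hits : HITs}.

(** * Currying two-variable maps *)

Lemma ap_ev_basepoint {A} {a0 : A} {Z} {z0 : Z} {f : PMap A a0 Z z0}
  (h : f = PMap_const) : ap (ev a0) h = projT2 f.
Proof. exact (projT2 (psec_htpy h)). Defined.

Definition bi_curry {A a0 B b0 Z z0} (F : @Bimap A a0 B b0 Z z0) (a : A)
  : PMap B b0 Z z0 := existT _ (F a) (bi_r F a).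

Definition bi_curry0 {A a0 B b0 Z z0} (F : @Bimap A a0 B b0 Z z0)
  : bi_curry F a0 = PMap_const :=
  psec_path (f := bi_curry F a0) (g := PMap_const) (existT _ (bi_l F) (bi_c F)).

Lemma ap_ev_bi_curry {A a0 B b0 Z z0} (F : @Bimap A a0 B b0 Z z0) (p : a0 = a0) (b : B) :
  ap (ev b) (conj (bi_curry0 F) (ap (bi_curry F) p)) = loopl F p b.
Proof.
  refine (conj_ap (ev b) (bi_curry0 F) _ @ _).
  exact (ap (fun t => conj t _) (ap_ev_psec_path _ b)
         @ ap (conj _) (!(ap_comp (ev b) (bi_curry F) p))).
Defined.

(** After currying, [fun_ext_K] leaves an equality of loops at the constant pointed map. Loop spaces
    being homogeneous, such loops agree as soon as they agree at each [b]. *)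
Lemma bimap_ext {G : AbGroup} (n : nat) {B} {b0 : B} {Z} {z0 : Z}
  (h : IsNType (S n) (PMap B b0 Z z0)) (F F' : Bimap (@K0 _ G (S n)) b0 z0)
  (e : forall x b, loopl F (sigma x) b = loopl F' (sigma x) b) :
  forall x b, F x b = F' x b.
Proof.
  assert (k : forall x, bi_curry F x = bi_curry F' x).
  { apply (fun_ext_K n h (bi_curry F) (bi_curry F') (bi_curry0 F @ !(bi_curry0 F'))).
    intros x. rewrite conj_conj. refine (!(conj_eq _ _ _ _)).
    apply PMap_loop_ext. intros b. rewrite !ap_ev_bi_curry. exact (!(e _ _)). }
  intros x b. exact (ap (ev b) (k x)).
Defined.

Lemma PMap_K_ntype {G H : AbGroup} {n m k : nat} (e : n + m = k) :
  IsNType n (PMap (K G m) K0 (K H k) K0).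
Proof. destruct e. apply PMap_ntype. Defined.

(** * Deloopings *)

(** [f] restricts along [sigma] to [f'] on loops. By [delooping_unique], identities between maps
    defined in every degree then follow by induction on the degree. *)
Definition Delooping {G H : AbGroup} {n k : nat} (f : K G (S n) -> K H (S k))
  (f' : K G n -> K H k) : Type :=
  {f0 : f K0 = K0 & forall x, conj f0 (ap f (sigma x)) = sigma (f' x)}.

Lemma delooping_comp {G H L : AbGroup} {n k j : nat}
  {f : K G (S n) -> K H (S k)} {f' : K G n -> K H k}
  {g : K H (S k) -> K L (S j)} {g' : K H k -> K L j}
  (dg : Delooping g g') (df : Delooping f f') :
  Delooping (fun x => g (f x)) (fun x => g' (f' x)).
Proof.
  destruct df as [f0 ef], dg as [g0 eg]. exists (ap g f0 @ g0). intros x.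
  rewrite conj_conj, (ap_comp g f), <- conj_ap, ef. apply eg.
Defined.

Lemma delooping_id {G : AbGroup} {n : nat} :
  Delooping (fun x : K G (S n) => x) (fun x => x).
Proof.
  exists idpath. intros x. exact (concat_1p _ @ ap_id _).
Defined.

Lemma delooping_unique {G H : AbGroup} {n k : nat} (h : IsNType (S n) (K H (S k)))
  {f g : K G (S n) -> K H (S k)} {f' g' : K G n -> K H k}
  (df : Delooping f f') (dg : Delooping g g') (e : forall x, f' x = g' x) :
  forall x, f x = g x.
Proof.
  destruct df as [f0 ef], dg as [g0 eg].
  apply (fun_ext_K n h f g (f0 @ !g0)). intros x.
  rewrite conj_conj. refine (!(conj_eq _ _ _ _)).
  rewrite ef, eg, e. exact idpath.
Defined.

Lemma delooping_K_map {G H : AbGroup} (phi : Hom G H) (n : nat) :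
  Delooping (K_map phi (S n)) (K_map phi n).
Proof. exact (existT _ (K_map0 phi (S n)) (sigma_natural' phi n)). Defined.

Definition K_cast {G : AbGroup} {j k : nat} (e : j = k) : K G j -> K G k :=
  transport (K G) e.

Lemma delooping_K_cast {G : AbGroup} {j k : nat} (e : S j = S k) (e' : j = k) :
  Delooping (@K_cast G _ _ e) (K_cast e').
Proof.
  rewrite (nat_path_prop e (ap S e')). destruct e'. apply delooping_id.
Defined.

(** * Signs *)

Lemma Susp_rec_loop {A X} (n s : X) (m : A -> n = s) (a a0 : A) :
  conj (projT1 (Susp_rec_beta n s m)) (ap (Susp_rec n s m) (merid a @ !(merid a0)))
  = m a @ !(m a0).
Proof.
  destruct (Susp_rec_beta n s m) as [bn [bs bm]]; cbn [projT1].
  assert (e : forall a, ap (Susp_rec n s m) (merid a) = bn @ m a @ !bs).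
  { intros b. exact (unwhisker _ bn bs @ ap (fun t => bn @ t @ !bs) (bm b)). }
  rewrite ap_pp, ap_V, !e. apply conj_whisker.
Defined.

Lemma raw_neg_loop {G : AbGroup} (n : nat) :
  {b : raw_neg (S n) (@raw0 _ G (S n)) = raw0 &
   forall x : rawK G n, conj b (ap (raw_neg (S n)) (raw_sigma x)) = !(raw_sigma x)}.
Proof.
  destruct n as [|n].
  - exact (K1_rec_beta star (fun g => !(loop g)) raw_neg_filler).
  - pose (m := fun a : rawK G (S n) => !(merid a @ !(merid raw0))).
    exists (projT1 (Susp_rec_beta north north m)). intros x.
    refine (Susp_rec_loop north north m x raw0 @ _). unfold m.
    (* The recursor yields [m x @ !(m raw0)], and [m raw0] is trivial. *)
    rewrite (concat_pV (merid raw0)). exact idpath.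
Defined.

Lemma K_rec_loop {G : AbGroup} {n : nat} {X : Type} (h : IsNType (S n) X)
  (f : rawK G (S n) -> X) {x0 : X} (b : f raw0 = x0) (x : rawK G n) :
  conj (K_rec_beta h f raw0 @ b) (ap (K_rec h f) (sigma (inK x)))
  = conj b (ap f (raw_sigma x)).
Proof.
  rewrite conj_conj, sigma_inK.
  rewrite <- (ap_homotopic (f := fun x => K_rec h f (inK x)) (K_rec_beta h f)).
  rewrite (ap_comp (K_rec h f) inK). exact idpath.
Defined.

Lemma sigma_path_ntype {G : AbGroup} {n : nat} (p q : @K0 _ G (S n) = K0) :
  IsNType n (p = q).
Proof. exact (hlevel_up (k := S n) (A := p = q) (K_ntype G (S n) _ _ p q)). Defined.

Lemma K_neg_loop {G : AbGroup} (n : nat) :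
  {b : K_neg (@K0 _ G (S n)) = K0 &
   forall x : K G n, conj b (ap K_neg (sigma x)) = !(sigma x)}.
Proof.
  destruct (@raw_neg_loop G n) as [b e].
  exists (K_rec_beta _ _ raw0 @ ap inK b).
  refine (projT1 (K_ind (fun x => sigma_path_ntype _ _) _)). intros x.
  refine (K_rec_loop _ (fun x => inK (raw_neg (S n) x)) (ap inK b) x @ _).
  rewrite (ap_comp inK (raw_neg (S n))), <- conj_ap, e, ap_V, sigma_inK. exact idpath.
Defined.

Definition sigma2 {G : AbGroup} {n : nat} (x : K G n)
  : @idpath _ (@K0 _ G (S (S n))) = idpath :=
  conj (sigma0 (S n)) (ap sigma (sigma x)).

(** In degree 0 this is additivity of [sigma]. In higher degrees both sides are compared on loops:
    [K_neg] inverts [sigma x], and inverting [sigma] pointwise inverts the resulting double loop by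
    [ap_loop2_inverse]. *)
Lemma sigma_neg {G : AbGroup} {n : nat} (x : K G n) : sigma (K_neg x) = !(sigma x).
Proof.
  destruct n as [|n].
  - apply path_of_concat_pV. rewrite inv_V, sigma_add.
    exact (ap (sigma (n := 0)) (addN x) @ sigma0 0).
  - destruct (@K_neg_loop G n) as [b e].
    revert x.
    apply (fun_ext_K n (K_ntype G (S (S n)) _ _) (fun x => sigma (K_neg x))
             (fun x => !(sigma x))
             ((ap sigma b @ sigma0 (S n)) @ !(ap inverse (sigma0 (S n))))).
    intros x. rewrite conj_conj. refine (!(conj_eq _ _ _ _)).
    rewrite conj_conj, (ap_comp sigma K_neg), <- conj_ap, e, ap_V.
    refine (ap_loop2_inverse sigma (sigma (inK x)) (sigma0 (S n)) _ @ _).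
    unfold conj. rewrite !inv_pp, inv_V. rewrite concat_pp. exact idpath.
Defined.

Lemma sigma2_neg {G : AbGroup} {n : nat} (x : K G n) : sigma2 (K_neg x) = !(sigma2 x).
Proof.
  unfold sigma2. rewrite sigma_neg, ap_V.
  unfold conj. rewrite !inv_pp, inv_V. rewrite concat_pp. exact idpath.
Defined.

Lemma delooping_K_neg {G : AbGroup} (n : nat) :
  Delooping (@K_neg _ G (S n)) (@K_neg _ G n).
Proof.
  destruct (@K_neg_loop G n) as [b e]. exists b. intros x.
  exact (e x @ !(sigma_neg x)).
Defined.

Lemma opp_unique {G : AbGroup} (x y : G) (h : add x y = zero) : x = opp y.
Proof.
  refine (!(add0 x) @ ap (fun t => add t x) (!(addN y)) @ !(addA _ _ _) @ _).
  refine (ap (add (opp y)) (addC y x @ h) @ addC _ _ @ add0 _).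
Defined.

Lemma K_neg_neg {G : AbGroup} {n : nat} (x : K G n) : K_neg (K_neg x) = x.
Proof.
  induction n as [|n IH].
  - refine (!(opp_unique x (opp x) _)). exact (addC _ _ @ addN x).
  - revert x. exact (delooping_unique (K_ntype G (S n))
      (delooping_comp (delooping_K_neg n) (delooping_K_neg n)) delooping_id IH).
Defined.

Lemma K_map_neg {G H : AbGroup} (phi : Hom G H) {n : nat} (x : K G n) :
  K_map phi n (K_neg x) = K_neg (K_map phi n x).
Proof.
  induction n as [|n IH].
  - apply (opp_unique (G := H)).
    exact (!(hom_add _ _ phi _ _) @ ap phi (addN x) @ hom0 phi).
  - revert x. exact (delooping_unique (K_ntype H (S n))
      (delooping_comp (delooping_K_map phi n) (delooping_K_neg n))
      (delooping_comp (delooping_K_neg n) (delooping_K_map phi n)) IH).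
Defined.

(** A boolean sign, [true] standing for plus, reduces the bookkeeping of parities to case
    analysis. *)
Definition K_bsign {G : AbGroup} {n : nat} (b : bool) (x : K G n) : K G n :=
  if b then x else K_neg x.

Lemma delooping_K_bsign {G : AbGroup} (b : bool) (n : nat) :
  Delooping (@K_bsign G (S n) b) (@K_bsign G n b).
Proof. destruct b; [exact delooping_id|apply delooping_K_neg]. Defined.

(** * Graded commutativity *)

Lemma cupP_loop {G1 G2 : AbGroup} (n m : nat) :
  {b : @cupP _ _ G1 G2 (S n) m K0 = PMap_const &
   forall x : K G1 n, conj b (ap cupP (sigma x)) = cup_loop (cupP x)}.
Proof.
  assert (raw : {b : raw_cup (S n) m (@raw0 _ G1 (S n)) = @PMap_const _ (@K0 _ G2 m) _ K0 &
     forall x : rawK G1 n, conj b (ap (raw_cup (S n) m) (raw_sigma x))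
       = cup_loop (raw_cup n m x)}).
  { destruct n as [|n].
    - exact (K1_rec_beta PMap_const (fun g => cup_loop (cup0 g)) cup_filler).
    - pose (c := fun a => cup_loop (@raw_cup _ _ G1 G2 (S n) m a)).
      exists (projT1 (Susp_rec_beta PMap_const PMap_const c)). intros x.
      refine (Susp_rec_loop PMap_const PMap_const c x raw0 @ _).
      (* The recursor gives [c x @ !(c raw0)]; the second factor vanishes because the cup product
         with the basepoint is zero. *)
      assert (c0 : c raw0 = idpath).
      { apply PMap_loop_ext. intros y. refine (ap_ev_PMap_loop _ _ y @ _).
        refine (ap sigma _ @ sigma0 _).
        destruct n as [|n].
        - exact (ap (ev y) (projT1 (K1_rec_beta PMap_const
                   (fun g => cup_loop (cup0 g)) cup_filler))).
        - exact (ap (ev y) (projT1 (Susp_rec_beta PMap_const PMap_const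
                   (fun a => cup_loop (@raw_cup _ _ G1 G2 (S n) m a))))). }
      rewrite c0. exact idpath. }
  destruct raw as [b e].
  exists (K_rec_beta _ _ raw0 @ b).
  refine (projT1 (K_ind _ _)).
  - intros x. apply (hlevel_up (k := S n)).
    exact (PMap_ntype G2 (Tensor G1 G2) (S n) m _ _ _ _).
  - intros x. refine (K_rec_loop _ (raw_cup (S n) m) b x @ e x @ _).
    exact (ap cup_loop (!(K_rec_beta _ _ x))).
Defined.

(** Coherence comes for free: the left trivialisation evaluates a path between pointed maps. *)
Definition cup_bimap {G1 G2 : AbGroup} (n m : nat)
  : Bimap (@K0 _ G1 (S n)) (@K0 _ G2 m) (@K0 _ (Tensor G1 G2) (S n + m)) :=
  mkBimap cup (fun y => ap (ev y) (projT1 (cupP_loop n m)))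
    (fun x => projT2 (cupP x)) (ap_ev_basepoint (projT1 (cupP_loop n m))).

Lemma loopl_cup {G1 G2 : AbGroup} {n m : nat} (x : K G1 n) (y : K G2 m) :
  loopl (cup_bimap n m) (sigma x) y = sigma (cup x y).
Proof.
  refine (_ @ ap (fun t => ap (ev y) t) (projT2 (cupP_loop n m) x)
          @ ap_ev_PMap_loop _ _ y).
  exact (ap (conj _) (ap_comp (ev y) cupP _) @ !(conj_ap (ev y) _ _)).
Defined.

Lemma cup_delooping {G1 G2 : AbGroup} {n m : nat} (y : K G2 m) :
  Delooping (fun x : K G1 (S n) => cup x y : K (Tensor G1 G2) (S (n + m)))
    (fun x => cup x y).
Proof. exact (existT _ (bi_l (cup_bimap n m) y) (fun x => loopl_cup x y)). Defined.

Definition cup_to {G1 G2 : AbGroup} {n m k : nat} (e : n + m = k)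
  (x : K G1 n) (y : K G2 m) : K (Tensor G1 G2) k := K_cast e (cup x y).

Definition cup_opp {G1 G2 : AbGroup} {n m k : nat} (e : m + n = k)
  (x : K G1 n) (y : K G2 m) : K (Tensor G1 G2) k :=
  K_map (tensor_swap G1 G2) k (cup_to e y x).

Lemma cup_to_delooping {G1 G2 : AbGroup} {n m k : nat} (e : S n + m = S k)
  (e' : n + m = k) (y : K G2 m) :
  Delooping (fun x : K G1 (S n) => cup_to e x y) (fun x => cup_to e' x y).
Proof. exact (delooping_comp (delooping_K_cast e e') (cup_delooping y)). Defined.

Lemma cup_opp_delooping {G1 G2 : AbGroup} {n m k : nat} (e : S m + n = S k)
  (e' : m + n = k) (x : K G1 n) :
  Delooping (fun y : K G2 (S m) => cup_opp e x y) (fun y => cup_opp e' x y).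
Proof.
  exact (delooping_comp (delooping_K_map _ k) (cup_to_delooping e e' x)).
Defined.

Definition bi_delooping {G H : AbGroup} {n k : nat} {f : K G (S n) -> K H (S k)}
  {f' : K G n -> K H k} (d : Delooping f f') {A a0 B b0}
  (F : @Bimap A a0 B b0 _ (@K0 _ G (S n))) : Bimap a0 b0 (@K0 _ H (S k)) :=
  bi_comp f (projT1 d) F.

Lemma loopl_bi_delooping {G H : AbGroup} {n k : nat} {f : K G (S n) -> K H (S k)}
  {f' : K G n -> K H k} (d : Delooping f f') {A a0 B b0}
  (F : @Bimap A a0 B b0 _ (@K0 _ G (S n))) (p : a0 = a0) (b : B) (u : K G n)
  (e : loopl F p b = sigma u) : loopl (bi_delooping d F) p b = sigma (f' u).
Proof. unfold bi_delooping. rewrite loopl_comp, e. apply (projT2 d). Defined.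

(** Computes the second looping once the first is known to be [sigma] of a map that itself deloops
    [g']. *)
Lemma delooping_sigma {G H : AbGroup} {n k : nat} {g : K G (S n) -> K H (S k)}
  {g' : K G n -> K H k} (d : Delooping g g')
  (h : K G (S n) -> @K0 _ H (S (S k)) = K0) (eh : forall x, h x = sigma (g x))
  (s : h K0 = idpath) (x : K G n) : conj s (ap h (sigma x)) = sigma2 (g' x).
Proof.
  destruct d as [g0 eg].
  rewrite (ap_loop2_homotopic eh (sigma x) s (ap sigma g0 @ sigma0 (S k))).
  rewrite conj_conj, (ap_comp sigma g), <- conj_ap, eg. exact idpath.
Defined.

(** Quantifying over the total degree [k] and both equalities lets each induction hypothesis be used
    with whatever casts occur. *)
Definition commutative_at (G1 G2 : AbGroup) (n m : nat) : Type :=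
  forall k (e : n + m = k) (e' : m + n = k) (x : K G1 n) (y : K G2 m),
    cup_to e x y = K_bsign (Nat.even (n * m)) (cup_opp e' x y).

Lemma cup_opp_opp {G1 G2 : AbGroup} {n m k : nat} (e : n + m = k)
  (x : K G1 n) (y : K G2 m) :
  K_map (tensor_swap G1 G2) k (cup_opp e y x) = cup_to e x y.
Proof. exact (K_map_cancel _ _ (tensor_swapK G2 G1) k _). Defined.

(** For fixed [x] both sides deloop in [y], so induction on [m] reduces to degree 0, where the swap
    acts on pure tensors. *)
Lemma commutative_0n (G1 G2 : AbGroup) (m : nat) : commutative_at G1 G2 0 m.
Proof.
  intros k e e' x y. simpl Nat.even. cbn [K_bsign]. revert k e e'.
  induction m as [|m IH]; intros k e e'.
  - destruct e. rewrite (nat_path_prop e' idpath). exact (!(tensor_swap_tens y x)).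
  - destruct e. revert y.
    refine (delooping_unique (K_ntype (Tensor G1 G2) (S m))
              (delooping_K_map (tens_hom x) m)
              (cup_opp_delooping (k := m) e' (addn_0 m) x) _).
    intros y. exact (IH y m idpath (addn_0 m)).
Defined.

Lemma commutative_n0 (G1 G2 : AbGroup) (n : nat) : commutative_at G1 G2 n 0.
Proof.
  intros k e e' x y. rewrite Nat.mul_0_r. cbn [Nat.even K_bsign].
  refine (!(cup_opp_opp e x y) @ _).
  exact (ap _ (!(commutative_0n G2 G1 n k e' e y x))).
Defined.

Lemma K_map_bsign {G H : AbGroup} (phi : Hom G H) {n : nat} (b : bool) (x : K G n) :
  K_map phi n (K_bsign b x) = K_bsign b (K_map phi n x).
Proof. destruct b; [exact idpath|apply K_map_neg]. Defined.

Lemma K_bsign_invol {G : AbGroup} {n : nat} (b : bool) (x : K G n) :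
  K_bsign b (K_bsign b x) = x.
Proof. destruct b; [exact idpath|apply K_neg_neg]. Defined.

Lemma nat_paths_of_eq {m n : nat} (e : Logic.eq m n) : m = n.
Proof. destruct e. exact idpath. Defined.

(** Modulo 2, [n * S m] equals [1 + S n * S m + S n * m + n * m]. The 1 is the sign of the
    transposition; the products are the signs of the goal and of the three induction hypotheses. *)
Lemma even_SS (n m : nat) : Logic.eq (Nat.even (n * S m))
  (negb (xorb (Nat.even (S n * S m)) (xorb (Nat.even (S n * m)) (Nat.even (n * m))))).
Proof.
  rewrite !Nat.even_mul, !Nat.even_succ, <- !Nat.negb_even.
  destruct (Nat.even n), (Nat.even m); reflexivity.
Defined.

Lemma K_neg_bsign3 {G : AbGroup} {n : nat} (b c d : bool) (x : K G n) :
  K_neg (K_bsign b (K_bsign c (K_bsign d x)))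
  = K_bsign (negb (xorb b (xorb c d))) x.
Proof.
  destruct b, c, d; simpl; rewrite ?K_neg_neg; exact idpath.
Defined.

Lemma bimap_ext2 {G1 G2 H : AbGroup} {n m k : nat} (e : m + n = k)
  (F F' : Bimap (@K0 _ G1 (S n)) (@K0 _ G2 (S m)) (@K0 _ H (S (S k))))
  (s : forall x, loopl F (sigma x) K0 = idpath)
  (s' : forall x, loopl F' (sigma x) K0 = idpath)
  (h : forall x y, conj (s x) (ap (loopl F (sigma x)) (sigma y))
                   = conj (s' x) (ap (loopl F' (sigma x)) (sigma y))) :
  forall x y, F x y = F' x y.
Proof.
  destruct e. apply (bimap_ext n).
  { apply PMap_K_ntype. apply nat_paths_of_eq.
    simpl. rewrite Nat.add_succ_r, Nat.add_comm. reflexivity. }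
  (* The first looping is again a two-variable map, now with values in loops. [bi_coherent] corrects
     only its right trivialisation, which [loopl] does not see. *)
  pose (B := fun (F0 : Bimap (@K0 _ G1 (S n)) (@K0 _ G2 (S m)) (@K0 _ H (S (S (m + n)))))
      (s0 : forall x, loopl F0 (sigma x) K0 = idpath) =>
    bi_coherent (a0 := K0) (b0 := K0) (fun Y x => loopl F0 (sigma x) Y) s0
      (fun Y => loopl_idpath F0 _ (sigma0 n) Y)).
  intros x Y.
  refine (bimap_ext m _ (B F s) (B F' s') (fun y x => h x y) Y x).
  apply (hlevel_PSec n (K_conn n)). intros _.
  exact (K_ntype H (S (S (m + n))) _ _).
Defined.

Lemma commutative_SS (G1 G2 : AbGroup) (n m : nat) :
  commutative_at G1 G2 n m -> commutative_at G1 G2 n (S m) ->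
  commutative_at G1 G2 (S n) m -> commutative_at G1 G2 (S n) (S m).
Proof.
  intros H00 H01 H10 k e e'.
  pose proof (even_SS n m) as parity.
  set (b := Nat.even (S n * S m)) in *.
  assert (en : n + S m = S (m + n)).
  { apply nat_paths_of_eq. rewrite Nat.add_succ_r, Nat.add_comm. reflexivity. }
  assert (en' : S n + m = S (m + n)).
  { apply nat_paths_of_eq. simpl. rewrite Nat.add_comm. reflexivity. }
  assert (em : m + S n = S (m + n)).
  { apply nat_paths_of_eq. apply Nat.add_succ_r. }
  assert (ek : n + m = m + n).
  { apply nat_paths_of_eq. apply Nat.add_comm. }
  (* Both sides are to be looped twice, so the total degree is put in the form of a double
     successor. *)
  assert (k2 : k = S (S (m + n))).
  { exact (!e' @ ap S em). }
  revert e e'. rewrite k2. intros e e'. clear k2 k.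
  pose (F := bi_delooping (delooping_K_cast e en) (@cup_bimap G1 G2 n (S m))).
  pose (Ft := bi_delooping (delooping_K_bsign b _)
     (bi_delooping (delooping_K_map (tensor_swap G1 G2) _)
       (bi_delooping (delooping_K_cast e' em) (@cup_bimap G2 G1 m (S n))))).
  assert (LF : forall x Y, loopl F (sigma x) Y = sigma (cup_to en x Y)).
  { intros x Y. apply (loopl_bi_delooping _ _ _ _ _ (loopl_cup x Y)). }
  assert (LFt : forall y X, loopl Ft (sigma y) X
                  = sigma (K_bsign b (cup_opp em X y))).
  { intros y X. refine (loopl_bi_delooping _ _ _ _ _ _).
    refine (loopl_bi_delooping _ _ _ _ _ _).
    exact (loopl_bi_delooping _ _ _ _ _ (loopl_cup y X)). }
  pose (F' := bi_flip Ft).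
  refine (bimap_ext2 idpath F F' (fun x => loopl_basepoint F _)
            (fun x => loopl_basepoint F' _) _).
  intros x y. rewrite (loopl_transpose F' _ _ _ (loopl_basepoint (bi_flip F') _)).
  (* Left side: looping in [x] gives [sigma (cup_to en x Y)]; [H01] reverses the product, which then
     loops in [Y]. *)
  refine (delooping_sigma
    (delooping_comp (delooping_K_bsign (Nat.even (n * S m)) _)
       (cup_opp_delooping idpath idpath x)) _
    (fun Y => LF x Y @ ap sigma (H01 _ en idpath x Y)) _ y @ _).
  (* [H10] is solved for the reversed product, signs being involutions; the result can be looped in
     [X]. *)
  assert (opp_eq : forall X : K G1 (S n), cup_opp em X y
                   = K_bsign (Nat.even (S n * m)) (cup_to en' X y)).
  { intros X. rewrite (H10 _ en' em X y). exact (!(K_bsign_invol _ _)). }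
  refine (_ @ ap inverse (!(delooping_sigma
    (delooping_comp (delooping_K_bsign b _)
       (delooping_comp (delooping_K_bsign (Nat.even (S n * m)) _)
          (@cup_to_delooping G1 G2 n m (m + n) en' ek y))) _
    (fun X => loopl_flip_flip Ft _ X @ LFt y X
       @ ap (fun t => sigma (K_bsign b t)) (opp_eq X)) _ x))).
  (* [H00] brings both sides to [cup_opp idpath x y], the inverse from the transposition becomes
     [K_neg], and [parity] matches the signs. *)
  rewrite (H00 _ ek idpath x y), <- sigma2_neg, K_neg_bsign3, parity.
  exact idpath.
Defined.

Lemma cup_graded_commutative (G1 G2 : AbGroup) (n m : nat) : commutative_at G1 G2 n m.
Proof.
  revert m; induction n as [|n IHn]; intros m; [apply commutative_0n|].
  induction m as [|m IHm]; [apply commutative_n0|].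
  (* The outer hypothesis, valid for every second degree, supplies two of the cases; the inner one
     supplies [(S n, m)]. *)
  exact (commutative_SS G1 G2 n m (IHn m) (IHn (S m)) IHm).
Defined.

End GradedCommutativity.

Theorem proposition31 (fe : Funext) (hits : HITs) (G1 G2 : AbGroup) (n m : nat)
  (x : K G1 n) (y : K G2 m) :
  paths (cup x y) (K_swap (K_sign (n * m) (cup y x))).
Proof.
  refine (cup_graded_commutative G1 G2 n m _ idpath (addn_comm m n) x y @ _).
  unfold K_swap, cup_opp, cup_to, K_cast.
  change (@K_sign hits) with (fun G k p => @K_bsign hits G k (Nat.even p)); cbv beta.
  (* With the degree cast contracted, it remains to commute the sign with the swap map. *)
  destruct (addn_comm m n); simpl.
  exact (!(K_map_bsign _ _ _)).
Qed.
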